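(* Let $m \ge 3$ be odd and $n = 3^m-1$. Then the ternary cyclic code $\mathcal{C}_{(2,3,m)}$ has parameters $[n,k,d]$ with $d \ge \frac{3^{(m-1)/2}+7}{2}$ if $m \equiv 3 \pmod 4$ and $d \ge \frac{3^{(m-1)/2}+5}{2}$ if $m \equiv 1 \pmod 4$, and $k = \frac{n}{2}$ if $m \equiv 3 \pmod 4$ and $k = \frac{n+2}{2}$ if $m \equiv 1 \pmod 4$.
   Context: Let $m \ge 2$ be an integer, $n = 3^m-1$, and let $\alpha$ be a primitive element of $\mathbb{F}_{3^m}$. For an integer $0 \le j \le n-1$ with $3$-adic expansion $j = \sum_{t=0}^{m-1} j_t 3^t$, $j_t \in \{0,1,2\}$, let $w_3(j) = \sum_{t=0}^{m-1} j_t$. For distinct $i_1, i_2 \in \{0,1,2,3\}$ let $T_{(i_1,i_2,m)} = \{1 \le j \le n-1 : w_3(j) \equiv i_1 \text{ or } i_2 \pmod 4\}$ and $g_{(i_1,i_2,m)}(x) = \prod_{j \in T_{(i_1,i_2,m)}} (x - \alpha^j) \in \mathbb{F}_3[x]$. $\mathcal{C}_{(i_1,i_2,m)}$ denotes the ternary cyclic code of length $n$ with generator polynomial $g_{(i_1,i_2,m)}(x)$. Parameters $[n,k,d]$ mean length, dimension over $\mathbb{F}_3$, and minimum Hamming distance. *)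

(* Defs.v *)
From HB Require Import structures.
From mathcomp Require Import all_boot all_order all_algebra all_field.
Set Implicit Arguments. Unset Strict Implicit. Unset Printing Implicit Defensive.
Import GRing.Theory.
Local Open Scope ring_scope.

Definition w3 (m j : nat) : nat := (\sum_(t < m) ((j %/ 3 ^ t) %% 3))%N.

Definition Tset (i1 i2 m : nat) : {set 'I_(3 ^ m - 1)} :=
  [set j : 'I_(3 ^ m - 1) | (0 < j)%N &&
     ((w3 m j %% 4 == i1)%N || (w3 m j %% 4 == i2)%N)].

(* generator polynomial g(x) = prod_{j in T} (x - alpha^j), computed in F[x]
   where F = GF(3^m) contains alpha (its coefficients lie in F_3). *)
Definition gpoly (F : fieldType) (alpha : F) (i1 i2 m : nat) : {poly F} :=
  \prod_(j in Tset i1 i2 m) ('X - (alpha ^+ j)%:P).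

(* the polynomial c(x) = sum_i c_i x^i of a ternary word, seen in F[x]
   via the prime-field embedding F_3 -> F (F has characteristic 3). *)
Definition cw_poly (F : fieldType) (n : nat) (c : 'rV['F_3]_n) : {poly F} :=
  \sum_(i < n) ((c 0 i : nat)%:R *: 'X^i).

(* The cyclic code C_(i1,i2,m) = the ideal generated by g in F_3[x]/(x^n-1):
   the words of length n whose polynomial is divisible by g. *)
Definition cyc_code (F : fieldType) (alpha : F) (i1 i2 m : nat)
  : {set 'rV['F_3]_(3 ^ m - 1)} :=
  [set c | gpoly alpha i1 i2 m %| cw_poly F c].

Definition code_dim (n : nat) (C : {set 'rV['F_3]_n}) : nat :=
  \dim <<enum C>>%VS.

Definition hamming_dist (n : nat) (x y : 'rV['F_3]_n) : nat :=
  #|[set i : 'I_n | x 0 i != y 0 i]|.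

Definition min_dist (n : nat) (C : {set 'rV['F_3]_n}) : nat :=
  (\big[minn/n]_(x in C) \big[minn/n]_(y in C | y != x) hamming_dist x y)%N.

(* Main.v *)
Require Import Defs.
From HB Require Import structures.
From mathcomp Require Import all_boot all_order all_algebra all_field.
From mathcomp Require Import zify.
Set Implicit Arguments. Unset Strict Implicit. Unset Printing Implicit Defensive.

(* Write m = 2h + 1 and n = 3^m - 1.  Frobenius maps alpha^j to alpha^(3j), which
   permutes the digits of j, so g has coefficients in F_3 and the dimension is
   n - |T|; |T| is counted digit by digit, since exactly one of x and x + 2 is
   2 or 3 modulo 4.  The distance is the BCH bound along a progression whose
   step v is coprime to n: v = n/2 + (3^h + 1) if h is odd, and
   v = n/2 - (3^(h+1) + 1) if h is even.  Since all digits of n/2 are 1, the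
   digit sums of the terms are explicit: up to a constant they are twice a digit
   sum of known parity, hence known modulo 4. *)

(** * Ternary digit sums and the size of [Tset 2 3 m] *)

Lemma w3S m j : w3 m.+1 j = j %% 3 + w3 m (j %/ 3).
Proof.
rewrite /w3 big_ord_recl /= expn0 divn1; congr (_ + _).
by apply: eq_bigr => i _; rewrite /= expnS -divnMA.
Qed.

Lemma w3_0 m : w3 m 0 = 0.
Proof. by rewrite /w3 big1 // => i _; rewrite div0n. Qed.

Lemma w3_1 x : w3 1 x = x %% 3.
Proof. by rewrite w3S [w3 0 _]big_ord0 addn0. Qed.

Lemma w3D a b x y : x < 3 ^ a -> w3 (a + b) (x + 3 ^ a * y) = w3 a x + w3 b y.
Proof.
elim: a x => [|a IH] x.
  rewrite expn0 ltnS leqn0 => /eqP->; by rewrite mul1n !add0n w3_0.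
rewrite expnS => ltx; rewrite addSn !w3S -addnA -IH; last by lia.
congr (_ + w3 _ _); first by rewrite -mulnA addnC mulnC modnMDl.
by rewrite -mulnA mulnC; lia.
Qed.

Lemma w3_widen a b x : x < 3 ^ a -> w3 (a + b) x = w3 a x.
Proof.
move=> ltx; rewrite -[x in LHS]addn0 -[X in x + X](muln0 (3 ^ a)).
by rewrite w3D // w3_0 addn0.
Qed.

(** Every power of 3 is odd. This parity, once doubled, fixes the digit sums of the progressions
    modulo 4. *)
Lemma odd_w3 m x : x < 3 ^ m -> odd (w3 m x) = odd x.
Proof.
elim: m x => [|m IH] x; first by rewrite expn0 ltnS leqn0 => /eqP->; rewrite w3_0.
rewrite expnS => ltx; rewrite w3S oddD IH; last by lia.
by rewrite [in RHS](divn_eq x 3) oddD oddM andbT addbC.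
Qed.

(** Subtracting from the all-twos number involves no borrow: each digit [d] becomes [2 - d]. *)
Lemma w3_compl m x : x < 3 ^ m -> w3 m (3 ^ m - 1 - x) + w3 m x = 2 * m.
Proof.
elim: m x => [|m IH] x; first by rewrite expn0 ltnS leqn0 => /eqP->; rewrite w3_0.
rewrite expnS => ltx; rewrite !w3S.
have lq : x %/ 3 < 3 ^ m by lia.
have -> : (3 * 3 ^ m - 1 - x) %/ 3 = 3 ^ m - 1 - x %/ 3 by lia.
have -> : (3 * 3 ^ m - 1 - x) %% 3 = 2 - x %% 3 by lia.
by have := IH _ lq; lia.
Qed.

(** Multiplication by 3 modulo [3 ^ m - 1] rotates the digits: in the proof [t] is the leading
    digit, which becomes the last one, and [q] is the rest. *)
Lemma w3_mul3 m j : j < 3 ^ m - 1 -> w3 m ((3 * j) %% (3 ^ m - 1)) = w3 m j.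
Proof.
case: m => [|m] ltj; first by [].
have := divn_eq j (3 ^ m); have := ltn_pmod j (expn_gt0 3 m).
set q := j %% _; set t := j %/ _ => ltq Ej.
rewrite expnS in ltj *.
have P : 0 < 3 ^ m by rewrite expn_gt0.
have ltt : t < 3 by rewrite ltn_divLR //; lia.
have -> : 3 * j = t * (3 * 3 ^ m - 1) + (3 * q + t) by rewrite Ej; nia.
rewrite modnMDl modn_small; last first.
  by move: ltj; rewrite Ej; case: t ltt {Ej} => [|[|[|]]] //; lia.
have Ej' : j = q + 3 ^ m * t by rewrite [LHS]Ej addnC mulnC.
rewrite w3S [in RHS]Ej' -[X in _ = w3 X _]addn1 w3D //.
have -> : (3 * q + t) %/ 3 = q by lia.
have -> : (3 * q + t) %% 3 = t by lia.
rewrite w3_1; lia.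
Qed.

(* With [b x := (2 <= x %% 4)] one has [b x + b x.+2 = 1], so summing over the
   last digit shifts the offset [c] by one. *)
Lemma sum_w3_ge2 m c :
  \sum_(0 <= j < 3 ^ m) (2 <= (w3 m j + c) %% 4) =
  (3 ^ m - 1) %/ 2 + (2 <= (m + c) %% 4).
Proof.
have split3 k (G : nat -> nat) :
    \sum_(0 <= j < 3 * k) G j =
    \sum_(0 <= j < k) (G (3 * j) + G (3 * j).+1 + G (3 * j).+2).
  elim: k => [|k IH]; first by rewrite muln0 !big_geq.
  by rewrite mulnS !big_nat_recr //= IH -!addnA.
elim: m c => [|m IH] c; first by rewrite expn0 big_nat1 w3_0.
rewrite expnS split3.
rewrite (eq_bigr (fun j => 1 + (2 <= (w3 m j + c.+1) %% 4))); last first.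
  move=> j _; rewrite !w3S.
  have -> : (3 * j) %/ 3 = j by lia.
  have -> : (3 * j).+1 %/ 3 = j by lia.
  have -> : (3 * j).+2 %/ 3 = j by lia.
  have -> : (3 * j) %% 3 = 0 by lia.
  have -> : (3 * j).+1 %% 3 = 1 by lia.
  have -> : (3 * j).+2 %% 3 = 2 by lia.
  lia.
rewrite big_split /= sum_nat_const_nat IH.
have : odd (3 ^ m) by rewrite oddX orbT.
by lia.
Qed.

Lemma mod4_23 x : (x %% 4 == 2) || (x %% 4 == 3) = (2 <= x %% 4).
Proof. lia. Qed.

(** The successor accounts for [3 ^ m - 1], which the sum includes but the index type does not: its
    digit sum [2 * m] is 2 modulo 4 for odd [m]. The index 0 contributes nothing. *)
Lemma card_Tset23 m : 0 < m -> odd m ->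
  (#|Tset 2 3 m|).+1 = (3 ^ m - 1) %/ 2 + (2 <= m %% 4).
Proof.
move=> m0 om; have := sum_w3_ge2 m 0.
rewrite addn0 => <-.
have P : 0 < 3 ^ m by rewrite expn_gt0.
rewrite -[in RHS](prednK P) big_nat_recr //= -subn1.
have := w3_compl P; rewrite subn0 w3_0 addn0 => ->.
rewrite (_ : 2 <= _ = true :> bool); last by lia.
rewrite big_mkord -addn1; congr (_ + _).
rewrite -sum1_card big_mkcond /=; apply: eq_bigr => j _.
rewrite inE mod4_23 addn0; case: posnP => [->|_]; first by rewrite w3_0.
by case: leqP.
Qed.

(** * Progressions whose digit sums are 2 or 3 modulo 4 *)

(** The witness is the number with [h] digits all equal to 1. Later identities become polynomial in
    it. *)
Lemma exp3_half h : exists2 a, 3 ^ h = 2 * a + 1 & odd a = odd h.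
Proof.
elim: h => [|h [a E o]]; first by exists 0.
exists (3 * a + 1); first by rewrite expnS E; lia.
by rewrite oddD oddM /= o addbT.
Qed.

Lemma exp3_double_half h a :
  3 ^ h = 2 * a + 1 -> 3 ^ (2 * h).+1 - 1 = 2 * (6 * (a * a) + 6 * a + 1).
Proof. by move=> Ea; rewrite expnS mul2n -addnn expnD Ea; clear; lia. Qed.

(* If [d] divides [3 ^ e + 1] and [3 ^ m - 1] with [2 * e = m -+ 1], then [d]
   divides [3 - 1]. *)
Lemma coprime_exp3_half h e v (b := (3 ^ (2 * h).+1 - 1) %/ 2) :
  odd v -> (forall d, d %| v -> d %| b -> d %| 3 ^ e + 1) ->
  e = h \/ e = h.+1 -> coprime v (3 ^ (2 * h).+1 - 1).
Proof.
have [a Ea _] := exp3_half h.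
rewrite {}/b (exp3_double_half Ea) mulKn //.
set b := (X in 2 * X) => ov dv Ee; rewrite coprimeMr coprimen2 ov /=.
apply/eqP; set d := gcdn v b.
have dV : d %| v by exact: dvdn_gcdl.
have dB : d %| b by exact: dvdn_gcdr.
have od : odd d by apply: dvdn_odd dV ov.
have dN : d %| 2 * b by apply: dvdn_mull.
have de := dv _ dV dB.
(* Modulo [3 ^ e + 1] a multiple of [n] is 2: [n = (3^h + 1)(3^(h+1) - 3) + 2] in the first case,
   [3n + 2 = (3^(h+1) + 1)(3^(h+1) - 1) + 2 - 2 + 2 - 2], that is [3n + 2 = 9^(h+1) - 1], in the
   second. *)
have d2 : d %| 2.
  case: Ee => Ee; rewrite Ee ?expnS Ea in de.
  - have := dvdn_mulr (6 * a) de.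
    have E : 2 * b = (2 * a + 1 + 1) * (6 * a) + 2 by rewrite /b; clear; lia.
    by move=> D; move: dN; rewrite E dvdn_addr.
  - have := dvdn_mulr (6 * a + 2) de.
    have -> : (3 * (2 * a + 1) + 1) * (6 * a + 2) = 3 * (2 * b) + 2.
      by rewrite /b; clear; lia.
    by rewrite dvdn_addr // dvdn_mull.
move: (dvdn_leq (isT : 0 < 2) d2) od; clearbody d; clear.
by case: d => [|[|[|]]].
Qed.

(* Multiples of the odd number [v] alternate between multiples of [3 ^ h + 1]
   and their translates by [n / 2], whose ternary digits are all 1. *)
Lemma w3_run_3mod4 h (m := (2 * h).+1) (n := 3 ^ m - 1) :
  odd h ->
  exists a v, coprime v n /\
    forall t, t < (3 ^ h + 5) %/ 2 -> 2 <= w3 m ((a + v * t) %% n) %% 4.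
Proof.
move=> oh; have [a Ea oa] := exp3_half h.
have h0 : 0 < h by case: h oh {m n Ea oa}.
have oa' : odd a by rewrite oa.
have a0 : 0 < a by case: a oa' {Ea oa}.
have Em : m = h + h.+1 by rewrite /m; clear; lia.
have En : n = 2 * (6 * (a * a) + 6 * a + 1) by rewrite /n (exp3_double_half Ea).
pose b := 6 * (a * a) + 6 * a + 1.
have Eb : b = 6 * (a * a) + 6 * a + 1 by [].
rewrite -/b in En; clearbody b.
have ob : odd b by rewrite Eb addn1 /= oddD !oddM.
have w31 : w3 h 1 = 1.
  by case: h h0 {oh m n Ea oa Em En} => // h _; rewrite w3S w3_0.
exists b, (b + 1 + 3 ^ h); split.
  apply: (@coprime_exp3_half h h) => //; last by left.
    by rewrite !(oddD, oddX) ob orbT.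
  move=> d d1; rewrite -/m -/n En mulKn // => d2.
  by move: d1; rewrite -addnA dvdn_addr // addnC.
move=> t ltt; have lea : t <= a + 2 by move: ltt; rewrite Ea; clear; lia.
(* For odd [t] the copies of [b] pair up into multiples of [n], leaving [t] written in two blocks:
   the digit sum is twice an odd number. *)
have [ot|et] := boolP (odd t).
  have Et := odd_double_half t; rewrite ot -muln2 in Et.
  have -> : b + (b + 1 + 3 ^ h) * t = (t./2).+1 * n + (t + 3 ^ h * t).
    by move: Et; move: (t./2) => s <-; rewrite En Ea; clear; lia.
  have [lt3|ge3] := ltnP t (3 ^ h).
    rewrite modnMDl [X in w3 _ X]modn_small; last first.
      have : (2 * a + 2) * t <= (2 * a + 2) * (2 * a).
        by rewrite leq_mul2l; apply/orP; right; move: lt3; rewrite Ea; clear; lia.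
      by move: a0; rewrite En Ea Eb; clear; move=> *; nia.
    rewrite Em w3D // -(addn1 h) w3_widen //.
    by have := odd_w3 lt3; rewrite ot; clear; lia.
  (* As [t <= a + 2], the block overflows only for [h = 1] and [t = 3], which is computed
     directly. *)
  have a1 : a = 1 by move: ge3 lea a0; rewrite Ea; clear; lia.
  have -> : t = 3 by move: ge3 lea; rewrite Ea a1; clear; lia.
  have hh : h = 1.
    apply/eqP; rewrite eqn_leq h0 andbT leqNgt; apply/negP => h2.
    by have := leq_pexp2l (isT : 0 < 3) h2; rewrite Ea a1.
  by rewrite modnMDl /n /m hh /w3 !big_ord_recl big_ord0.
have Et := odd_double_half t; rewrite (negbTE et) add0n -muln2 in Et.
have -> : b + (b + 1 + 3 ^ h) * t = (t./2) * n + (b + t + 3 ^ h * t).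
  by move: Et; move: (t./2) => s <-; rewrite En Ea; clear; lia.
rewrite modnMDl.
have [lta|gta] := leqP t a.
  (* The all-ones number [b] splits into blocks [a], [a] and a leading 1. The digit sum is
     [2 * w3 h (a + t) + 1] with [a + t] odd. *)
  have -> : b + t + 3 ^ h * t = (a + t) + 3 ^ h * (a + t + 3 ^ h * 1).
    by rewrite Eb Ea; clear; lia.
  have lt2 : a + t < 2 * a.
    have : t != a by apply: contra et => /eqP->.
    by move: lta; clear; lia.
  have lt3 : a + t < 3 ^ h by move: lt2; rewrite Ea; clear; lia.
  rewrite [X in w3 _ X]modn_small; last first.
    have : (2 * a + 2) * (a + t) <= (2 * a + 2) * (2 * a).
      by rewrite leq_mul2l (ltnW lt2) orbT.
    by move: a0; rewrite En Ea Eb; clear; move=> *; nia.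
  rewrite Em w3D // -(addn1 h) w3D // w3_1.
  by have := odd_w3 lt3; rewrite oddD oa' (negbTE et); clear; lia.
have -> : t = a.+1.
  have : t != a.+2 by apply: contra et => /eqP->; rewrite /= oa'.
  by move: lea gta; clear; lia.
(* Here [a + t] reaches [3 ^ h], so both blocks carry; the remaining digits are 1 and 2. *)
have -> : b + a.+1 + 3 ^ h * a.+1 = 0 + 3 ^ h * (1 + 3 ^ h * 2).
  by rewrite Eb Ea; clear; lia.
rewrite [X in w3 _ X]modn_small; last by move: a0; rewrite En Ea Eb; clear; move=> *; nia.
rewrite Em w3D ?expn_gt0 // -(addn1 h) w3D; last by rewrite Ea; move: a0; clear; lia.
by rewrite w31 w3_0 w3_1.
Qed.

(** The terms are [v * i] for [1 <= i <= a + 2]. Even [i] gives the negative of [i] repeated in two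
    blocks, odd [i] the same translated by [n / 2]. *)
Lemma w3_run_1mod4 h (m := (2 * h).+1) (n := 3 ^ m - 1) :
  0 < h -> ~~ odd h ->
  exists a v, coprime v n /\
    forall t, t < (3 ^ h + 3) %/ 2 -> 2 <= w3 m ((a + v * t) %% n) %% 4.
Proof.
move=> h0 oh; have [a Ea oa] := exp3_half h.
have a4 : 4 <= a.
  have h2 : 2 <= h by case: h h0 oh {m n Ea oa} => [|[|]].
  by have := leq_pexp2l (isT : 0 < 3) h2; rewrite Ea; clear; lia.
have oa' : ~~ odd a by rewrite oa.
have Em : m = h.+1 + h by rewrite /m; clear; lia.
have S : 3 ^ h.+1 = 6 * a + 3 by rewrite expnS Ea; clear; lia.
have En : n = 2 * (6 * (a * a) + 6 * a + 1) by rewrite /n (exp3_double_half Ea).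
pose b := 6 * (a * a) + 6 * a + 1.
have Eb : b = 6 * (a * a) + 6 * a + 1 by [].
rewrite -/b in En; clearbody b.
have Xm : 3 ^ m = n.+1 by rewrite /n subn1 prednK // expn_gt0.
have ob : odd b by rewrite Eb addn1 /= oddD !oddM.
have w31 : w3 h 1 = 1.
  by case: h h0 {oh m n Ea oa Em S En Xm} => // h _; rewrite w3S w3_0.
(* This is [b - (3 ^ h.+1 + 1)] expressed in [a]. *)
pose v := 6 * (a * a) - 3.
have Ev : v + (1 + 3 ^ h.+1) = b by rewrite /v Eb S; move: a4; clear; move=> *; nia.
clearbody v.
exists v, v; split.
  apply: (@coprime_exp3_half h h.+1) => //; last by right.
    by move: ob; rewrite -Ev oddD (oddD 1) oddX orbT /= addbF.
  move=> d d1; rewrite -/m -/n En mulKn // => d2.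
  by move: d2; rewrite -Ev dvdn_addr // addnC.
move=> t ltt; rewrite -mulnS.
have lei : t.+1 <= a + 2 by move: ltt; rewrite Ea; clear; lia.
move: t.+1 (ltn0Sn t) lei => {t ltt} i i0 lei.
have lt3 : i < 3 ^ h by move: lei a4; rewrite Ea; clear; lia.
have lt3' : i < 3 ^ h.+1 by move: lei a4; rewrite S; clear; lia.
have vi : v * i + (i + 3 ^ h.+1 * i) = b * i by rewrite -Ev; clear; lia.
have [oi|ei] := boolP (odd i); last first.
  have Ei := odd_double_half i; rewrite (negbTE ei) add0n -muln2 in Ei.
  have lt : i + 3 ^ h.+1 * i < n.
    have : (6 * a + 4) * i <= (6 * a + 4) * (a + 2) by rewrite leq_mul2l lei orbT.
    by move: a4; rewrite En S Eb; clear; move=> *; nia.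
  (* One copy of [n] is kept back so that the natural subtraction does not truncate. The digit sum
     is then [2 * m - 2 * w3 h i] with [w3 h i] even. *)
  have -> : v * i = (i./2).-1 * n + (n - (i + 3 ^ h.+1 * i)).
    have E1 : b * i = (i./2).-1 * n + n.
      rewrite -mulSnr prednK; last by move: i0 Ei; clear; lia.
      by move: Ei; move: (i./2) => s <-; rewrite En; clear; lia.
    by move: vi lt; rewrite E1; clear; lia.
  have ltm : i + 3 ^ h.+1 * i < 3 ^ m by rewrite Xm ltnW.
  rewrite modnMDl [X in w3 _ X]modn_small; last first.
    by move: i0 lt; move: (3 ^ h.+1 * i); clear; lia.
  have := w3_compl ltm; rewrite -/n {2}Em w3D // -(addn1 h) w3_widen //.
  by have := odd_w3 lt3; rewrite (negbTE ei) /m; clear; lia.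
have Ei := odd_double_half i; rewrite oi -muln2 in Ei.
have [lta|gta] := leqP i a.
  (* Subtracting from [b] blockwise needs no borrow between blocks; the middle digit 1 survives, and
     [a - i] is odd. *)
  have -> : v * i = (i./2) * n + (a - i + 3 ^ h * 1 + 3 ^ h.+1 * (a - i)).
    have E1 : b * i = i./2 * n + b by move: Ei; move: (i./2) => s <-; rewrite En; clear; lia.
    have E2 : b = a + 3 ^ h * 1 + 3 ^ h.+1 * a by rewrite S Ea Eb; clear; lia.
    have : 3 ^ h.+1 * i <= 3 ^ h.+1 * a by rewrite leq_mul2l lta orbT.
    by move: vi lta; rewrite E1 E2 mulnBr; clear; lia.
  have lta3 : a - i < 3 ^ h by rewrite Ea; clear; lia.
  rewrite modnMDl [X in w3 _ X]modn_small; last first.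
    have : (6 * a + 4) * (a - i) <= (6 * a + 4) * a by rewrite leq_mul2l leq_subr orbT.
    by rewrite S Ea En Eb; clear; move=> *; nia.
  rewrite Em w3D; last by rewrite S Ea; clear; lia.
  rewrite -(addn1 h) w3D // w3_1.
  by have := odd_w3 lta3; rewrite oddB // oi (negbTE oa'); clear; lia.
(* The one odd index beyond [a]. The residue is the complement of [1 + 2 * 3 ^ h], with digit sum
   [2 * m - 3], which is 3 modulo 4 because [h] is even. *)
have Ei' : i = a.+1.
  have : i != a.+2 by apply: contraL oi => /eqP->; rewrite /= negbK.
  by move: lei gta; clear; lia.
have lt : 1 + 3 ^ h * 2 < n by rewrite En Ea Eb; move: a4; clear; move=> *; nia.
have -> : v * i = (i./2).-1 * n + (n - (1 + 3 ^ h * 2)).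
  have E1 : b * i = (i./2).-1 * n + n + b.
    rewrite -mulSnr prednK; last by move: a4 Ei Ei'; clear; lia.
    by move: Ei; move: (i./2) => s <-; rewrite En; clear; lia.
  have : i + 3 ^ h.+1 * i = b + (1 + 3 ^ h * 2) by rewrite Ei' S Ea Eb; clear; lia.
  by move: vi lt; rewrite E1; clear; lia.
have ltm : 1 + 3 ^ h * 2 < 3 ^ m by rewrite Xm ltnW.
rewrite modnMDl [X in w3 _ X]modn_small; last by move: lt; move: (3 ^ h * 2); clear; lia.
have := w3_compl ltm; rewrite -/n.
have -> : w3 m (1 + 3 ^ h * 2) = 3.
  have -> : m = h + h.+1 by rewrite /m; clear; lia.
  by rewrite w3D ?w31 ?w3S ?w3_0 // Ea; move: a4; clear; lia.
by rewrite /m; clear; lia.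
Qed.

Import GRing.Theory.
Local Open Scope ring_scope.

(** * The embedding of the prime field and descent to it *)

(** The coefficient map of [cw_poly], with the characteristic as an argument so that it can be
    declared a ring morphism. *)
Definition embF3 (F : fieldType) (c3 : 3%N \in [pchar F]) (x : 'F_3) : F :=
  (x : nat)%:R.

Section EmbF3.

Variables (F : fieldType) (c3 : 3%N \in [pchar F]).

Fact embF3_is_zmod_morphism : zmod_morphism (embF3 c3).
Proof.
have embD : {morph embF3 c3 : x y / x + y}.
  by move=> x y; rewrite /embF3 -natrD -(GRing.natr_mod_pchar c3 (_ + _)%N).
by move=> x y; apply/eqP; rewrite eq_sym subr_eq -embD subrK.
Qed.

Fact embF3_is_monoid_morphism : monoid_morphism (embF3 c3).
Proof.
by split=> // x y; rewrite /embF3 -natrM -(GRing.natr_mod_pchar c3 (_ * _)%N).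
Qed.

HB.instance Definition _ :=
  GRing.isZmodMorphism.Build 'F_3 F (embF3 c3) embF3_is_zmod_morphism.
HB.instance Definition _ :=
  GRing.isMonoidMorphism.Build 'F_3 F (embF3 c3) embF3_is_monoid_morphism.

Lemma cw_polyE n (c : 'rV['F_3]_n) :
  cw_poly F c = map_poly (embF3 c3) (rVpoly c).
Proof.
apply/polyP=> k; rewrite coef_map coef_sum.
have [ltk|gek] := ltnP k n.
  rewrite (bigD1 (Ordinal ltk)) //= coefZ coefXn eqxx mulr1 big1 ?addr0.
    by rewrite (coef_rVpoly_ord c (Ordinal ltk)).
  move=> i /negPf ne; rewrite coefZ coefXn -val_eqE /= eq_sym in ne *.
  by rewrite ne mulr0.
rewrite nth_default ?(leq_trans (size_poly _ _)) // raddf0 big1 // => i _.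
by rewrite coefZ coefXn gtn_eqF ?mulr0 // (leq_trans (ltn_ord i)).
Qed.

(** Each coefficient satisfies [x^3 = x], hence is a root of [x (x - 1) (x + 1)] and comes from
    [F_3]. *)
Lemma poly_descent_F3 (p : {poly F}) :
  map_poly (pFrobenius_aut c3) p = p -> exists q, p = map_poly (embF3 c3) q.
Proof.
move=> pK.
(* An inverse of [embF3] on its image; the default [-1] is reached only by coefficients equal to
   [-1]. *)
pose rho (x : F) : 'F_3 := if x == 0 then 0 else if x == 1 then 1 else -1.
exists (map_poly rho p); apply/polyP=> i.
rewrite coef_map coef_map_id0 ?/rho ?eqxx //.
have := congr1 (fun r : {poly F} => r`_i) pK; rewrite coef_map /=.
rewrite pFrobenius_autE; move: p`_i => x x3.
case: eqP => [->|/eqP x0]; first by rewrite rmorph0.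
case: eqP => [->|/eqP x1]; first by rewrite rmorph1.
have : x * (x - 1) * (x + 1) == 0.
  by rewrite -mulrA -subr_sqr expr1n mulrBr mulr1 -exprS x3 subrr.
rewrite !mulf_eq0 (negPf x0) subr_eq0 (negPf x1) /= addr_eq0 => /eqP->.
by rewrite rmorphN1.
Qed.

End EmbF3.

(** * The BCH bound *)

(** If the support had at most [L] points, a polynomial of degree below [L] would vanish at all of
    them but [i0]. The moments make its weighted sum zero, forcing [c i0 = 0]. *)
Lemma sparse_vandermonde (F : fieldType) (I : finType) (x c : I -> F) L :
  injective x -> (exists i, c i != 0) ->
  (forall t, (t < L)%N -> \sum_i c i * x i ^+ t = 0) ->
  (L < #|[set i | (c i != 0)%R]|)%N.
Proof.
move=> injx [i0 ci0] mom; rewrite ltnNge; apply/negP => leL.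
pose S := [set i | c i != 0] :\ i0.
pose q := \prod_(i in S) ('X - (x i)%:P).
have szq : (size q <= L)%N.
  rewrite /q -big_enum size_prod_XsubC -cardE.
  by rewrite (leq_trans _ leL) // (cardsD1 i0 [set i | _]) inE ci0.
have : \sum_i c i * q.[x i] = 0.
  under eq_bigr => i _ do rewrite (horner_coef_wide _ szq) mulr_sumr.
  rewrite exchange_big big1 //= => t _.
  under eq_bigr => i _ do rewrite mulrCA.
  by rewrite -mulr_sumr mom ?mulr0.
rewrite (bigD1 i0) //= big1 => [|i nei].
  move/eqP; rewrite addr0 mulf_eq0 (negPf ci0) /= /q horner_prod.
  apply/negP/prodf_neq0 => i; rewrite !inE hornerXsubC subr_eq0 => /andP[ne _].
  by apply: contra ne => /eqP/injx->.
have [->|ci] := eqVneq (c i) 0; first by rewrite mul0r.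
by rewrite /q (bigD1 i) ?inE ?nei //= hornerM hornerXsubC subrr mul0r mulr0.
Qed.

(** The evaluations are power moments with nodes [alpha ^+ (v * i)] and weights [c_i alpha^(i a)].
    Coprimality of [v] and [n] keeps the nodes distinct. *)
Lemma bch_bound (F : fieldType) (c3 : 3%N \in [pchar F]) n (alpha : F) a v L
    (c : 'rV['F_3]_n) :
  n.-primitive_root alpha -> coprime v n -> c != 0 ->
  (forall t, (t < L)%N -> root (cw_poly F c) (alpha ^+ (a + v * t))) ->
  (L < #|[set i | (c 0 i != 0)%R]|)%N.
Proof.
move=> prim_al cop nzc zeros.
have prim_be : n.-primitive_root (alpha ^+ v) by rewrite prim_root_exp_coprime.
have nz_al : alpha != 0.
  by rewrite (prim_root_eq0 prim_al) -lt0n (prim_order_gt0 prim_al).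
pose d (i : 'I_n) := embF3 c3 (c 0 i) * alpha ^+ (i * a).
have nzd i : (d i != 0) = (c 0 i != 0).
  by rewrite /d mulf_eq0 negb_or fmorph_eq0 expf_neq0 ?andbT.
have <- : [set i | d i != 0] = [set i | c 0 i != 0].
  by apply/setP=> i; rewrite !inE nzd.
apply: (@sparse_vandermonde _ _ (fun i : 'I_n => alpha ^+ v ^+ i)).
- move=> i j /eqP; rewrite (eq_prim_root_expr prim_be) !modn_small //.
  by move/eqP/val_inj.
- have /rV0Pn[i ci] := nzc; by exists i; rewrite nzd.
move=> t /zeros/rootP; rewrite /cw_poly horner_sum => root_t; rewrite -[RHS]root_t.
apply: eq_bigr => i _; rewrite /d hornerZ hornerXn -mulrA; congr (_ * _).
by rewrite -!exprM -exprD; congr (_ ^+ _); clear; lia.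
Qed.

(** * From codeword weights and roots to the minimum distance *)

Lemma leq_bigmin (I : finType) (P : pred I) (G : I -> nat) n d :
  (d <= n)%N -> (forall i, P i -> (d <= G i)%N) ->
  (d <= \big[minn/n]_(i | P i) G i)%N.
Proof.
by move=> dn dG; elim/big_ind: _ => // x y dx dy; rewrite leq_min dx dy.
Qed.

(** Differences of codewords are codewords. Both nested minima start from the length, whence the
    first bound on [d]. *)
Lemma min_dist_ge (F : fieldType) (c3 : 3%N \in [pchar F]) (alpha : F)
    i1 i2 m d :
  (d <= 3 ^ m - 1)%N ->
  (forall c, c \in cyc_code alpha i1 i2 m -> c != 0 ->
     (d <= #|[set i | (c 0 i != 0)%R]|)%N) ->
  (d <= min_dist (cyc_code alpha i1 i2 m))%N.
Proof.
move=> dn wt; apply: leq_bigmin => // x Cx.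
apply: leq_bigmin => // y /andP[Cy nxy].
rewrite /hamming_dist.
have -> : [set i | x 0 i != y 0 i] = [set i | (x - y) 0 i != 0].
  by apply/setP=> i; rewrite !inE !mxE subr_eq0.
apply: wt; last by rewrite subr_eq0 eq_sym.
move: Cx Cy; rewrite !inE !(cw_polyE c3) !raddfB /= => dx dy.
by rewrite dvdp_sub.
Qed.

Lemma root_cyc_code (F : fieldType) (alpha : F) i1 i2 m c k :
  (3 ^ m - 1)%N.-primitive_root alpha -> c \in cyc_code alpha i1 i2 m ->
  (0 < k %% (3 ^ m - 1))%N ->
  (w3 m (k %% (3 ^ m - 1)) %% 4 == i1)%N ||
    (w3 m (k %% (3 ^ m - 1)) %% 4 == i2)%N ->
  root (cw_poly F c) (alpha ^+ k).
Proof.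
move=> prim_al; rewrite inE => dvd k0 wk.
have ltk : (k %% (3 ^ m - 1) < 3 ^ m - 1)%N.
  by rewrite ltn_mod (prim_order_gt0 prim_al).
rewrite -(prim_expr_mod prim_al) -dvdp_XsubCl; apply: dvdp_trans dvd.
by rewrite /gpoly (bigD1 (Ordinal ltk)) ?dvdp_mulr //= inE k0.
Qed.

(* [T] is stable under [j |-> 3 * j], so Frobenius permutes the roots of [g]. *)
Lemma gpoly_Frobenius (F : fieldType) (c3 : 3%N \in [pchar F]) (alpha : F)
    i1 i2 m :
  (3 ^ m - 1)%N.-primitive_root alpha ->
  map_poly (pFrobenius_aut c3) (gpoly alpha i1 i2 m) = gpoly alpha i1 i2 m.
Proof.
move=> prim_al; have n0 := prim_order_gt0 prim_al.
set n := (3 ^ m - 1)%N in prim_al n0 *.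
pose f (j : 'I_n) : 'I_n := Ordinal (ltn_pmod (3 * j) n0).
have cop3 : coprime n 3.
  rewrite coprime_sym prime_coprime //; apply/negP => d3.
  have m0 : (0 < m)%N by have := n0; rewrite /n; case: (m).
  have := dvdn_exp m0 (dvdnn 3); rewrite -(@subnK 1 (3 ^ m)) ?expn_gt0 //.
  by rewrite dvdn_addr.
have finj : injective f.
  have prim_al3 : n.-primitive_root (alpha ^+ 3).
    by rewrite prim_root_exp_coprime // coprime_sym.
  move=> i j /(congr1 val)/= /eqP.
  rewrite -(eq_prim_root_expr prim_al) !exprM (eq_prim_root_expr prim_al3).
  by rewrite !modn_small // => /eqP; exact: val_inj.
rewrite /gpoly map_prod_XsubC [RHS](reindex_inj finj) /=.
apply: eq_big => [j|j _].
  rewrite !inE w3_mul3 ?ltn_ord //; congr (_ && _).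
  rewrite [LHS]lt0n [RHS]lt0n; congr (~~ _).
  (* [f] is injective and fixes 0, so it preserves nonzero indices. *)
  by have := inj_eq finj j (Ordinal n0); rewrite -!val_eqE /= muln0 mod0n => ->.
by rewrite pFrobenius_autE -exprM mulnC (prim_expr_mod prim_al).
Qed.

(** * The dimension of the code *)

(** Multiplication by [g] is an injective linear map from polynomials of degree below [n - s] onto
    the code. *)
Lemma dim_multiples n s (g : {poly 'F_3}) : size g = s.+1 -> (s <= n)%N ->
  code_dim [set c : 'rV['F_3]_n | g %| rVpoly c] = (n - s)%N.
Proof.
move=> szg les; set k := (n - s)%N.
have nzg : g != 0 by rewrite -size_poly_gt0 szg.
pose phi (u : 'rV['F_3]_k) : 'rV_n := poly_rV (rVpoly u * g).
have phi_lin : linear phi.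
  by move=> b u v; rewrite /phi linearP mulrDl -scalerAl linearP.
pose L := GRing.isLinear.Build _ _ _ _ phi phi_lin.
pose Phi : {linear 'rV['F_3]_k -> 'rV['F_3]_n} := HB.pack phi L.
have phiK u : rVpoly (phi u) = rVpoly u * g.
  rewrite poly_rV_K //; apply: leq_trans (size_polyMleq _ _) _.
  have : (size (rVpoly u) <= k)%N by exact: size_poly.
  by rewrite szg addnS /= -(subnK les) leq_add2r.
rewrite /code_dim; set C := [set _ | _].
have -> : <<enum C>>%VS = limg (linfun Phi).
  apply/vspaceP=> c; apply/idP/memv_imgP => [Cc|[u _ ->]]; last first.
    by apply: memv_span; rewrite mem_enum inE lfunE /= phiK dvdp_mulIr.
  have : c \in limg (linfun Phi).
    apply: subvP Cc; apply/span_subvP => {}c; rewrite mem_enum inE => /dvdpP[q Eq].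
    apply/memv_imgP; exists (poly_rV q); first exact: memvf.
    rewrite lfunE /= /phi poly_rV_K -?Eq ?rVpolyK //.
    have [->|nzq] := eqVneq q 0; first by rewrite size_poly0.
    have : (size (rVpoly c) <= n)%N by exact: size_poly.
    by rewrite Eq size_mul // szg addnS /= -{1}(subnK les) leq_add2r.
  by case/memv_imgP=> u; exists u.
rewrite limg_dim_eq; first by rewrite dimvf dim_matrix; apply: mul1n.
rewrite capfv; apply/eqP/lker0P => u v; rewrite !lfunE /= => E.
have := congr1 rVpoly E; rewrite !phiK => /(mulIf nzg)/(congr1 poly_rV).
by move=> /(_ k); rewrite !rVpolyK.
Qed.

(** The generator descends to [g0] over [F_3], and divisibility is unchanged by the field
    extension. *)
Lemma dim_cyc_code (F : fieldType) (c3 : 3%N \in [pchar F]) (alpha : F)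
    i1 i2 m :
  (3 ^ m - 1)%N.-primitive_root alpha ->
  code_dim (cyc_code alpha i1 i2 m) = (3 ^ m - 1 - #|Tset i1 i2 m|)%N.
Proof.
move=> prim_al.
have [g0 Eg] := poly_descent_F3 (gpoly_Frobenius c3 i1 i2 prim_al).
have szg : size g0 = (#|Tset i1 i2 m|).+1.
  rewrite -(size_map_poly (embF3 c3)) -Eg /gpoly -big_enum.
  by rewrite size_prod_XsubC -cardE.
have -> : cyc_code alpha i1 i2 m = [set c | g0 %| rVpoly c].
  by apply/setP=> c; rewrite !inE Eg (cw_polyE c3) dvdp_map.
apply: dim_multiples szg _.
by rewrite -[X in (_ <= X)%N]card_ord max_card.
Qed.

(** * Distance and dimension combined for residues 2 and 3 *)

Lemma min_dist_cyc_code23 (F : fieldType) (c3 : 3%N \in [pchar F]) (alpha : F)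
    m a v L :
  (3 ^ m - 1)%N.-primitive_root alpha -> coprime v (3 ^ m - 1) ->
  (forall t, t < L -> 2 <= w3 m ((a + v * t) %% (3 ^ m - 1)) %% 4)%N ->
  (L < 3 ^ m - 1)%N -> (L < min_dist (cyc_code alpha 2 3 m))%N.
Proof.
move=> prim_al cop run ltL; apply: (min_dist_ge c3) => // c Cc nzc.
apply: (bch_bound (a := a) c3 prim_al cop nzc) => t /run wt.
apply: (root_cyc_code prim_al Cc); last by rewrite mod4_23.
(* [Tset] omits the exponent 0, but the run never meets it, as its digit sum is 0. *)
by rewrite lt0n; apply: contraTneq wt => ->; rewrite w3_0.
Qed.

Local Close Scope ring_scope.

Theorem theorem6 (m : nat) (F : finFieldType) (alpha : F) :
  (3 <= m)%N -> odd m -> #|F| = (3 ^ m)%N ->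
  ((3 ^ m - 1)%N.-primitive_root alpha)%R ->
  let n := (3 ^ m - 1)%N in
  let C := cyc_code alpha 2 3 m in
  (m %% 4 = 3 ->
     ((3 ^ ((m - 1) %/ 2) + 7) %/ 2 <= min_dist C)%N /\ code_dim C = n %/ 2) /\
  (m %% 4 = 1 ->
     ((3 ^ ((m - 1) %/ 2) + 5) %/ 2 <= min_dist C)%N /\ code_dim C = (n + 2) %/ 2).
Proof.
move=> m3 om cardF prim_al n C.
have c3 : (3 \in [pchar F])%R by apply: card_finPcharP cardF _.
have m0 : 0 < m by apply: leq_trans m3.
have cardT := card_Tset23 m0 om.
have dimC := dim_cyc_code c3 2 3 prim_al.
have [a Ea _] := exp3_half ((m - 1) %/ 2).
have Em : m = (2 * ((m - 1) %/ 2)).+1 by move: m3 om; clear; lia.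
have En : n = 2 * (6 * (a * a) + 6 * a + 1).
  by rewrite -(exp3_double_half Ea) -Em.
have h0 : 0 < (m - 1) %/ 2 by move: m3; clear; lia.
have a0 : 0 < a.
  by have := leq_pexp2l (isT : 0 < 3) h0; rewrite Ea; clear; lia.
split=> m4.
  have oh : odd ((m - 1) %/ 2) by move: m3 m4; clear; lia.
  have [b [v [cop run]]] := w3_run_3mod4 oh; rewrite -Em in cop run.
  split; last first.
    rewrite dimC; move: cardT; rewrite m4; move: #|_| => s.
    by rewrite -/n En; clear; lia.
  (* A run of [L] consecutive zeros gives distance at least [L + 1]. *)
  rewrite (_ : (_ + 7) %/ 2 = ((3 ^ ((m - 1) %/ 2) + 5) %/ 2).+1); last by clear; lia.
  apply: (min_dist_cyc_code23 c3 prim_al cop run).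
  by rewrite -/n En Ea; move: (a * a) a0; clear; lia.
have oh : ~~ odd ((m - 1) %/ 2) by move: m3 m4; clear; lia.
have [b [v [cop run]]] := w3_run_1mod4 h0 oh; rewrite -Em in cop run.
split; last first.
  rewrite dimC; move: cardT; rewrite m4; move: #|_| => s.
  by rewrite -/n En; clear; lia.
rewrite (_ : (_ + 5) %/ 2 = ((3 ^ ((m - 1) %/ 2) + 3) %/ 2).+1); last by clear; lia.
apply: (min_dist_cyc_code23 c3 prim_al cop run).
by rewrite -/n En Ea; move: (a * a) a0; clear; lia.
Qed.
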